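(* Let $G_1$, $G_2$, $H_1$ and $H_2$ be graphs. Then: (1) $\max\{\mathrm{C}(G_1\times G_2;H_1),\mathrm{C}(G_1\times G_2;H_2)\}\leq \mathrm{C}(G_1\times G_2;H_1\times H_2)$ and $\mathrm{C}(G_1\times G_2;H_1\times H_2)\leq \min\{\mathrm{C}(G_1;H_1)\cdot \mathrm{C}(G_2;H_2),\ \mathrm{C}(G_1;H_1\times H_2),\ \mathrm{C}(G_2;H_1\times H_2)\}$. (2) $\mathrm{IC}(G_1\times G_2;H_1\times H_2)\leq \mathrm{IC}(G_1;H_1)\cdot \mathrm{IC}(G_2;H_2)$.
   Context: ''Graph'' means either an undirected graph (loops allowed) or a directed graph (a set of vertices with a binary relation), without multiple edges; all graphs in the statement are of the same kind. The vertex and edge (arc) sets of $G$ are $V(G)$, $E(G)$. A homomorphism $f:G\to H$ is a map $f:V(G)\to V(H)$ with $f(u)f(v)\in E(H)$ whenever $uv\in E(G)$; it is injective if it is injective on vertices and the induced map on edges is injective (the former implies the latter). A subgraph of $G$ is a graph whose vertex and edge sets are subsets of $V(G)$, $E(G)$. The union $G_1\cup\cdots\cup G_k$ has vertex set $\bigcup_i V(G_i)$ and edge set $\bigcup_i E(G_i)$. The graph product $G_1\times G_2$ has vertex set $V(G_1)\times V(G_2)$, and $(u_1,u_2)(v_1,v_2)\in E(G_1\times G_2)$ if and only if $u_1v_1\in E(G_1)$ and $u_2v_2\in E(G_2)$. The hom-complexity $\mathrm{C}(G;H)$ is the least positive integer $k$ such that there are subgraphs $G_1,\dots,G_k$ of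 $G$ with $G=G_1\cup\cdots\cup G_k$ and, for each $i$, a homomorphism $G_i\to H$; $\mathrm{C}(G;H)=\infty$ if no such $k$ exists. The injective hom-complexity $\mathrm{IC}(G;H)$ is defined in the same way, requiring for each $i$ an injective homomorphism $G_i\to H$. Products with a factor $\infty$ equal $\infty$. *)

(* Defs.v *)
From HB Require Import structures.
From mathcomp Require Import all_boot all_order all_algebra.
From mathcomp Require Import boolp classical_sets constructive_ereal.

Set Implicit Arguments.
Unset Strict Implicit.
Unset Printing Implicit Defensive.
Local Open Scope classical_set_scope.

Variant graph_kind := Undirected | Directed.

(* An undirected edge {u, v} is encoded by the two ordered pairs (u, v) and
   (v, u); in the directed case (u, v) is the arc from u to v. *)
Record graph (k : graph_kind) := Graph {
  vertex : Type;
  edges : set (vertex * vertex);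
  edges_sym : k = Undirected ->
    forall u v, edges (u, v) -> edges (v, u) }.
Arguments vertex {k} g.
Arguments edges {k} g.

Definition same_edge (k : graph_kind) (T : Type) (e e' : T * T) : Prop :=
  match k with
  | Directed => e = e'
  | Undirected => e = e' \/ e = (e'.2, e'.1)
  end.

Definition is_hom (k : graph_kind) (G H : graph k)
    (f : vertex G -> vertex H) : Prop :=
  forall u v, edges G (u, v) -> edges H (f u, f v).

Definition is_inj_hom (k : graph_kind) (G H : graph k)
    (f : vertex G -> vertex H) : Prop :=
  [/\ is_hom f, injective f &
      forall e e', edges G e -> edges G e' ->
        same_edge k (f e.1, f e.2) (f e'.1, f e'.2) -> same_edge k e e'].

Record subgraph (k : graph_kind) (G : graph k) := Subgraph {
  sub_vertices : set (vertex G);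
  sub_edges : set (vertex G * vertex G);
  sub_edges_subset : sub_edges `<=` edges G;
  sub_edges_ends : sub_edges `<=` sub_vertices `*` sub_vertices;
  sub_edges_sym : k = Undirected ->
    forall u v, sub_edges (u, v) -> sub_edges (v, u) }.
Arguments sub_vertices {k G} s.
Arguments sub_edges {k G} s.

Definition graph_of_subgraph (k : graph_kind) (G : graph k) (S : subgraph G) :
    graph k :=
  @Graph k {u : vertex G | sub_vertices S u}
    [set e | sub_edges S (sval e.1, sval e.2)]
    (fun hk u v => @sub_edges_sym k G S hk (sval u) (sval v)).

Definition is_union (k : graph_kind) (G : graph k) (n : nat)
    (S : 'I_n -> subgraph G) : Prop :=
  \bigcup_i sub_vertices (S i) = [set: vertex G] /\
  \bigcup_i sub_edges (S i) = edges G.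

Definition gprod_edges (k : graph_kind) (G1 G2 : graph k) :
    set ((vertex G1 * vertex G2) * (vertex G1 * vertex G2)) :=
  [set e | edges G1 (e.1.1, e.2.1) /\ edges G2 (e.1.2, e.2.2)].
Arguments gprod_edges {k} G1 G2.

Lemma gprod_edges_sym (k : graph_kind) (G1 G2 : graph k) :
  k = Undirected -> forall u v,
  gprod_edges G1 G2 (u, v) -> gprod_edges G1 G2 (v, u).
Proof. by move=> hk u v [h1 h2]; split; apply: (edges_sym hk). Qed.

Definition gprod (k : graph_kind) (G1 G2 : graph k) : graph k :=
  Graph (@gprod_edges_sym k G1 G2).

(* The value lives in [\bar int] rather than [\bar nat] because the library's
   multiplication of extended numbers requires a numDomainType. *)
Definition least_pos (P : nat -> Prop) : \bar int :=
  if pselect (exists n, `[< (0 < n)%N /\ P n >]) is left h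
  then ((ex_minn h)%:Z)%:E%E else +oo%E.

Definition hom_complexity (k : graph_kind) (G H : graph k) : \bar int :=
  least_pos (fun n => exists S : 'I_n -> subgraph G, is_union S /\
    forall i, exists f : vertex (graph_of_subgraph (S i)) -> vertex H,
      is_hom f).

Definition inj_hom_complexity (k : graph_kind) (G H : graph k) : \bar int :=
  least_pos (fun n => exists S : 'I_n -> subgraph G, is_union S /\
    forall i, exists f : vertex (graph_of_subgraph (S i)) -> vertex H,
      is_inj_hom f).

(* Main.v *)
(* Homomorphisms pull back decompositions of the target to the source and
   push forward along the codomain, so the projections of the two products
   give every bound except the multiplicative ones.  For those, if the A_i
   decompose G1 and the B_j decompose G2 then the A_i x B_j decompose
   G1 x G2, and (injective) homomorphisms on A_i and B_j pair up to one on
   A_i x B_j. *)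
Require Import Defs.
From mathcomp Require Import all_boot all_order all_algebra.
From mathcomp Require Import boolp classical_sets constructive_ereal.

Import Order.TTheory.

Set Implicit Arguments.
Unset Strict Implicit.
Unset Printing Implicit Defensive.
Local Open Scope ereal_scope.

(** Records only that a finite value is positive and attained; minimality is supplied separately by
    [least_pos_le]. *)
Variant least_pos_spec (P : nat -> Prop) : \bar int -> Prop :=
  | LeastPosFin n of (0 < n)%N & P n : least_pos_spec P (n%:Z)%:E
  | LeastPosInfty : least_pos_spec P +oo.

Lemma least_posP (P : nat -> Prop) : least_pos_spec P (least_pos P).
Proof.
rewrite /least_pos; case: pselect => [h|_]; last exact: LeastPosInfty.
by case: ex_minnP => n /asboolP[n_gt0 Pn] _; apply: LeastPosFin.
Qed.

Lemma least_pos_le (P : nat -> Prop) (n : nat) :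
  (0 < n)%N -> P n -> least_pos P <= (n%:Z)%:E.
Proof.
move=> n_gt0 Pn; rewrite /least_pos; case: pselect => [h|[]]; last first.
  by exists n; apply/asboolP.
by case: ex_minnP => m _ /(_ n (asboolT (conj n_gt0 Pn))); rewrite lee_fin.
Qed.

Lemma least_pos_mono (P Q : nat -> Prop) :
  (forall n, P n -> Q n) -> least_pos Q <= least_pos P.
Proof.
move=> PQ; case: (least_posP P) => [n n_gt0 /PQ|]; last exact: leey.
exact: least_pos_le.
Qed.

Lemma least_pos_gt0 (P : nat -> Prop) : 0 < least_pos P.
Proof. by case: least_posP => [n|]; rewrite ?lte_fin ?ltry. Qed.

(** If both values are finite, the product of the two witnesses is a witness for [R]. Otherwise the
    right side is [+oo], because values of [least_pos] are positive and the convention [0 * +oo = 0]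
    never comes into play. *)
Lemma least_pos_mul (P Q R : nat -> Prop) :
  (forall m n, P m -> Q n -> R (m * n)%N) ->
  least_pos R <= least_pos P * least_pos Q.
Proof.
move=> PQR; have := least_pos_gt0 Q.
case: (least_posP P) => [m m_gt0 Pm|] Q_gt0; last by rewrite gt0_mulye ?leey.
case: (least_posP Q) => [n n_gt0 Qn|].
  by apply: least_pos_le; [rewrite muln_gt0 m_gt0 | apply: PQR].
by rewrite gt0_muley ?leey.
Qed.

(** Applying [f] to both ends commutes with swapping them, so each case of [same_edge] reduces to
    injectivity on the ends. *)
Lemma same_edge_inj (k : graph_kind) (T U : Type) (f : T -> U) (e e' : T * T) :
  injective f ->
  same_edge k (f e.1, f e.2) (f e'.1, f e'.2) -> same_edge k e e'.
Proof.
move=> f_inj; case: e e' => [u v] [u' v'].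
by case: k => /= [[]|] [/f_inj-> /f_inj->]; [left|right|].
Qed.

#[local] Obligation Tactic := idtac.

Section Graphs.
Variable k : graph_kind.
Implicit Types G H : graph k.
Local Open Scope classical_set_scope.

Lemma is_inj_homP G H (f : vertex G -> vertex H) :
  is_inj_hom f <-> is_hom f /\ injective f.
Proof.
split=> [[]//|[f_hom f_inj]]; split=> // e e' _ _.
exact: same_edge_inj.
Qed.

(** The intersection with [edges G] matters: [f] may send a non-edge of [G] to an edge of [S]. *)
Program Definition preimage_subgraph G H (f : vertex G -> vertex H)
    (S : subgraph H) : subgraph G :=
  @Subgraph k G (f @^-1` sub_vertices S)
    (edges G `&` [set e | sub_edges S (f e.1, f e.2)]) _ _ _.
Next Obligation. by move=> G H f S e []. Qed.
Next Obligation. by move=> G H f S e [_ /sub_edges_ends]. Qed.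
Next Obligation.
by move=> G H f S hk u v [/(edges_sym hk) ? /(sub_edges_sym hk)].
Qed.

Lemma preimage_subgraph_union {G H} (f : vertex G -> vertex H) {n}
    (S : 'I_n -> subgraph H) :
  is_hom f -> is_union S -> is_union (fun i => preimage_subgraph f (S i)).
Proof.
move=> f_hom [Sv Se]; split; apply/seteqP; split=> //.
- move=> u _; have : [set: vertex H] (f u) by [].
  by rewrite -Sv => -[i _ ?]; exists i.
- by move=> e [i _ []].
- move=> [u v] uv; have := f_hom _ _ uv.
  by rewrite -Se => -[i _ ?]; exists i.
Qed.

(** A decomposition of [G'] pulls back along [f] with the same number of parts; [f] restricts to a
    map from each preimage to its part, which is then composed with the homomorphism to [H]. *)
Lemma hom_complexity_dom {G G'} H (f : vertex G -> vertex G') :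
  is_hom f -> (hom_complexity G H <= hom_complexity G' H)%E.
Proof.
move=> f_hom; apply: least_pos_mono => n [S [S_union S_hom]].
exists (fun i => preimage_subgraph f (S i)).
split; first exact: preimage_subgraph_union.
move=> i; have [g g_hom] := S_hom i.
exists (fun u => g (exist (sub_vertices (S i)) (f (sval u)) (svalP u))).
by move=> u v [_ uv]; apply: g_hom.
Qed.

Lemma hom_complexity_cod G {H H'} (g : vertex H -> vertex H') :
  is_hom g -> (hom_complexity G H' <= hom_complexity G H)%E.
Proof.
move=> g_hom; apply: least_pos_mono => n [S [S_union S_hom]].
exists S; split=> // i; have [f f_hom] := S_hom i.
by exists (g \o f) => u v /f_hom/g_hom.
Qed.

Lemma fst_hom G1 G2 : @is_hom k (gprod G1 G2) G1 fst.
Proof. by move=> u v []. Qed.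

Lemma snd_hom G1 G2 : @is_hom k (gprod G1 G2) G2 snd.
Proof. by move=> u v []. Qed.

Program Definition prod_subgraph G1 G2 (A : subgraph G1) (B : subgraph G2) :
    subgraph (gprod G1 G2) :=
  @Subgraph k (gprod G1 G2) (sub_vertices A `*` sub_vertices B)
    [set e | sub_edges A (e.1.1, e.2.1) /\ sub_edges B (e.1.2, e.2.2)] _ _ _.
Next Obligation.
by move=> G1 G2 A B e [/sub_edges_subset ? /sub_edges_subset].
Qed.
Next Obligation.
by move=> G1 G2 A B e [/sub_edges_ends[? ?] /sub_edges_ends[? ?]].
Qed.
Next Obligation.
by move=> G1 G2 A B hk u v [/(sub_edges_sym hk) ? /(sub_edges_sym hk)].
Qed.

(** Abstracting the condition on the parts lets one argument serve both the plain and the injective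
    complexity. *)
Lemma prod_subgraph_cover G1 G2 m n (P : subgraph G1 -> Prop)
    (Q : subgraph G2 -> Prop) (R : subgraph (gprod G1 G2) -> Prop) :
  (forall A B, P A -> Q B -> R (prod_subgraph A B)) ->
  (exists S : 'I_m -> subgraph G1, is_union S /\ forall i, P (S i)) ->
  (exists S : 'I_n -> subgraph G2, is_union S /\ forall i, Q (S i)) ->
  exists S : 'I_(m * n) -> subgraph (gprod G1 G2),
    is_union S /\ forall i, R (S i).
Proof.
move=> PQR [A [[Av Ae] PA]] [B [[Bv Be] QB]].
(* The bijection from ['I_(m * n)] to pairs of indices is the one that flattens a matrix into a row
   vector; [p] is the inverse of [mxvec_index]. *)
pose p i := enum_val (cast_ord (esym (mxvec_cast m n)) i).
have pK i j : p (mxvec_index i j) = (i, j).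
  by rewrite /p /mxvec_index cast_ordK enum_rankK.
exists (fun i => prod_subgraph (A (p i).1) (B (p i).2)).
split=> [|i]; last exact: PQR.
split; apply/seteqP; split=> //.
- move=> [u1 u2] _.
  have : [set: vertex G1] u1 by []; rewrite -Av => -[i _ Ai].
  have : [set: vertex G2] u2 by []; rewrite -Bv => -[j _ Bj].
  by exists (mxvec_index i j); rewrite ?pK.
- by move=> e [i _ /sub_edges_subset].
- move=> e []; rewrite -Ae -Be => -[i _ Ai] [j _ Bj].
  by exists (mxvec_index i j); rewrite ?pK.
Qed.

Definition prod_subgraph_map G1 G2 H1 H2 (A : subgraph G1) (B : subgraph G2)
    (f : vertex (graph_of_subgraph A) -> vertex H1)
    (g : vertex (graph_of_subgraph B) -> vertex H2)
    (u : vertex (graph_of_subgraph (prod_subgraph A B))) :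
    vertex (gprod H1 H2) :=
  (f (exist (sub_vertices A) (sval u).1 (proj1 (svalP u))),
   g (exist (sub_vertices B) (sval u).2 (proj2 (svalP u)))).

Lemma prod_subgraph_map_hom G1 G2 H1 H2 (A : subgraph G1) (B : subgraph G2)
    (f : vertex (graph_of_subgraph A) -> vertex H1)
    (g : vertex (graph_of_subgraph B) -> vertex H2) :
  is_hom f -> is_hom g -> is_hom (prod_subgraph_map f g).
Proof.
by move=> f_hom g_hom u v [uv1 uv2]; split; [apply: f_hom|apply: g_hom].
Qed.

Lemma prod_subgraph_map_inj G1 G2 H1 H2 (A : subgraph G1) (B : subgraph G2)
    (f : vertex (graph_of_subgraph A) -> vertex H1)
    (g : vertex (graph_of_subgraph B) -> vertex H2) :
  injective f -> injective g -> injective (prod_subgraph_map f g).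
Proof.
move=> f_inj g_inj [[u1 u2] hu] [[v1 v2] hv] [/f_inj[uv1] /g_inj[uv2]].
(* Membership proofs are irrelevant, so equal coordinates in [G1] and [G2] suffice. *)
by apply: eq_exist; rewrite uv1 uv2.
Qed.

Definition hom_to H {G} (S : subgraph G) : Prop :=
  exists f : vertex (graph_of_subgraph S) -> vertex H, is_hom f.

Definition inj_hom_to H {G} (S : subgraph G) : Prop :=
  exists f : vertex (graph_of_subgraph S) -> vertex H, is_inj_hom f.

End Graphs.

Theorem theorem3p23 (k : graph_kind) (G1 G2 H1 H2 : graph k) :
  (maxe (hom_complexity (gprod G1 G2) H1) (hom_complexity (gprod G1 G2) H2)
     <= hom_complexity (gprod G1 G2) (gprod H1 H2) /\
   hom_complexity (gprod G1 G2) (gprod H1 H2)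
     <= mine (hom_complexity G1 H1 * hom_complexity G2 H2)
          (mine (hom_complexity G1 (gprod H1 H2))
                (hom_complexity G2 (gprod H1 H2)))) /\
  inj_hom_complexity (gprod G1 G2) (gprod H1 H2)
    <= inj_hom_complexity G1 H1 * inj_hom_complexity G2 H2.
Proof.
split; [split|].
(* Lower bounds: compose with the projections of the target [gprod H1 H2]. *)
- by rewrite ge_max (hom_complexity_cod _ (@fst_hom _ _ _))
    (hom_complexity_cod _ (@snd_hom _ _ _)).
(* The projections of the source [gprod G1 G2] settle the last two bounds, leaving the
   multiplicative one. *)
- rewrite !le_min (hom_complexity_dom _ (@fst_hom _ _ _))
    (hom_complexity_dom _ (@snd_hom _ _ _)) !andbT.
  apply: least_pos_mul => m n.
  apply: (prod_subgraph_cover (P := hom_to H1) (Q := hom_to H2)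
    (R := hom_to (gprod H1 H2))).
  move=> A B [f ?] [g ?].
  by exists (prod_subgraph_map f g); apply: prod_subgraph_map_hom.
- apply: least_pos_mul => m n.
  apply: (prod_subgraph_cover (P := inj_hom_to H1) (Q := inj_hom_to H2)
    (R := inj_hom_to (gprod H1 H2))).
  move=> A B [f /is_inj_homP[? ?]] [g /is_inj_homP[? ?]].
  exists (prod_subgraph_map f g); apply/is_inj_homP.
  by split; [apply: prod_subgraph_map_hom|apply: prod_subgraph_map_inj].
Qed.
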